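(* Let $X=X_1\times\cdots\times X_k$ with each $X_i$ finite, and let $F:X\to\{-1,+1\}$. Fix a function $H:X\to\{-1,+1\}$ and a probability distribution $P$ on $X$. Put \[\alpha=P(F^{-1}(-1)\cap H^{-1}(-1)),\quad \beta=P(F^{-1}(-1)\cap H^{-1}(+1)),\quad Q=\log\frac{\alpha}{\beta+\mathrm{disc}_P(H)}.\] Then, in the $k$-party number-on-forehead model, \[N(F)\geq Q \qquad\text{and}\qquad \mathit{MA}(F)\geq\min\left\{\Omega(\sqrt Q),\ \Omega\!\left(\frac{Q}{\log(2/\alpha)}\right)\right\}.\]
   Context: A cylinder intersection is a function $\chi:X_1\times\cdots\times X_k\to\{0,1\}$ of the form $\chi(x_1,\dots,x_k)=\prod_{i=1}^k\phi_i(x_1,\dots,x_{i-1},x_{i+1},\dots,x_k)$ for some functions $\phi_i$ into $\{0,1\}$ not depending on $x_i$. For a distribution $\mu$ on $X$, $\mathrm{disc}_\mu(F)=\max_\chi\left|\sum_{x\in X}\mu(x)F(x)\chi(x)\right|$, the maximum over cylinder intersections $\chi$. In the number-on-forehead model player $i$ sees all $x_j$, $j\ne i$, and players write bits on a shared blackboard. $N(F)$ is the least cost $c_1+c_2$ of a nondeterministic protocol ($c_1$ nondeterministic bits, then $c_2$ deterministic bits of communication), correct for at least one nondeterministic choice on inputs with $F=-1$ and for all choices on inputs with $F=+1$. $\mathit{MA}(F)$ is the least cost $c_1+c_2$ of a Merlin-Arthur protocol: $c_1$ nondeterministic bits followed by $c_2$ bits of public-coin randomized communication, with error probability at most $1/3$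 for at least one nondeterministic choice when $F=-1$ and for all nondeterministic choices when $F=+1$. Logarithms are base 2. *)

(* Defs.v *)
From HB Require Import structures.
From mathcomp Require Import all_boot all_order all_algebra.
From mathcomp Require Import all_classical all_reals all_analysis.

Set Implicit Arguments.
Unset Strict Implicit.
Unset Printing Implicit Defensive.

Import Order.TTheory GRing.Theory Num.Theory.

Local Open Scope classical_set_scope.
Local Open Scope ring_scope.

Notation input X := {dffun forall i, X i}.

Definition pm1 (T : Type) (f : T -> int) : Prop :=
  forall x, f x = -1 \/ f x = 1.

Definition is_distr (R : realType) (T : finType) (p : T -> R) : Prop :=
  (forall x, 0 <= p x) /\ \sum_x p x = 1.

(* With the library convention [ln x = 0] for [x <= 0]. *)
Definition log2 (R : realType) (x : R) : R := ln x / ln 2.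

Section NumberOnForehead.
Context {k : nat} {X : 'I_k -> finType}.

(* The tuple (x_1, .., x_{i-1}, x_{i+1}, .., x_k): a function of type
   [view i -> _] is a function that does not depend on x_i. *)
Definition view (i : 'I_k) : Type := forall j : 'I_k, j != i -> X j.

Definition see (x : input X) (i : 'I_k) : view i := fun j _ => x j.
Arguments see x i : clear implicits.

(* {0,1} is [bool], so the product of the phi_i is their conjunction. *)
Definition cylinder_intersection (chi : input X -> bool) : Prop :=
  exists phi : forall i : 'I_k, view i -> bool,
    forall x, chi x = [forall i, phi i (see x i)].

(* The default value 0 of the maximum is harmless: all terms are nonnegative
   and the constant 1 is a cylinder intersection. *)
Definition disc {R : realType} (mu : input X -> R) (f : input X -> int) : R :=
  \big[Num.max/0]_(chi : {ffun input X -> bool} |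
                     `[< cylinder_intersection chi >])
    `| \sum_x mu x * (f x)%:~R * (chi x)%:R |.

(* A node is a blackboard content: it determines which player i writes the next
   bit, and how that bit is computed from what player i sees.  The output is
   determined by the final blackboard content. *)
Inductive protocol : Type :=
| Output of bool
| Write (i : 'I_k) of view i -> bool & protocol & protocol.

Fixpoint cost (p : protocol) : nat :=
  match p with
  | Output _ => 0
  | Write _ _ p0 p1 => (maxn (cost p0) (cost p1)).+1
  end.

(* A leaf labelled [true] outputs -1. *)
Fixpoint run (p : protocol) (x : input X) : int :=
  match p with
  | Output b => (-1) ^+ b
  | Write i f p0 p1 => if f (see x i) then run p1 x else run p0 x
  end.

Definition nondet_protocol (f : input X -> int) (c1 c2 : nat)
    (p : c1.-tuple bool -> protocol) : Prop :=
  [/\ forall w, (cost (p w) <= c2)%N,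
      forall x, f x = -1 -> exists w, run (p w) x = f x &
      forall x, f x = 1 -> forall w, run (p w) x = f x].

(* The least cost, in the extended reals since it is +oo when no protocol
   exists (which can happen only for k = 1). *)
Definition N_nof (R : realType) (f : input X -> int) : \bar R :=
  ereal_inf [set c%:R%:E | c in
    [set c : nat | exists c1 c2 (p : c1.-tuple bool -> protocol),
       nondet_protocol f c2 p /\ c = (c1 + c2)%N]].

(* A public-coin randomized protocol is a probability distribution [mu] on a
   finite set of coin outcomes, each selecting a deterministic protocol. *)
Definition error_prob (R : realType) (f : input X -> int) (W : finType)
    (mu : W -> R) (p : W -> protocol) (x : input X) : R :=
  \sum_(r | run (p r) x != f x) mu r.

Definition MA_protocol (R : realType) (f : input X -> int) (c1 c2 : nat)
    (W : finType) (mu : W -> R) (p : c1.-tuple bool -> W -> protocol) : Prop :=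
  [/\ is_distr mu,
      forall w r, (cost (p w r) <= c2)%N,
      forall x, f x = -1 -> exists w, error_prob f mu (p w) x <= 1 / 3 &
      forall x, f x = 1 -> forall w, error_prob f mu (p w) x <= 1 / 3].

Definition MA_nof (R : realType) (f : input X -> int) : \bar R :=
  ereal_inf [set c%:R%:E | c in
    [set c : nat | exists c1 c2 (W : finType) (mu : W -> R)
         (p : c1.-tuple bool -> W -> protocol),
       MA_protocol f c2 mu p /\ c = (c1 + c2)%N]].

End NumberOnForehead.
Arguments see {k X} x i j _.

(* Main.v *)
Require Import Defs.
From HB Require Import structures.
From mathcomp Require Import all_boot all_order all_algebra.
From mathcomp Require Import all_classical all_reals all_analysis.
From mathcomp Require Import zify ring lra.

Set Implicit Arguments.
Unset Strict Implicit.
Unset Printing Implicit Defensive.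

Import Order.TTheory GRing.Theory Num.Theory.

Local Open Scope classical_set_scope.
Local Open Scope ring_scope.

(* A deterministic protocol of cost c accepts a disjoint union of at most 2^c
   cylinder intersections, so the P-masses of its accepting sets inside H = -1
   and H = +1 differ by at most 2^c disc_P(H).  Average this over the coins and
   sum over the 2^c1 nondeterministic choices of a protocol with error eps:
   every input counted by alpha is accepted with probability at least 1 - eps
   for some choice, while inputs with H = +1 are accepted with mass at most
   beta + eps for each choice.  Hence
     (1 - eps) alpha <= 2^c1 (beta + eps + 2^c2 disc_P(H)).
   For eps = 0 this is the bound on N(F).  For MA(F), majority voting over
   O(c1 + log (2 / alpha)) runs first reduces eps to at most 2^-c1 alpha / 4,
   so that Q = O(c^2 + c log (2 / alpha)) with c = c1 + c2; the case c = 0, where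
   the additive constant cannot be absorbed, is treated apart. *)

(** * Cylinder intersections and composition of protocols *)

Section Protocols.
Context {k : nat} {X : 'I_k -> finType}.
Implicit Types (x : input X) (p : @protocol k X) (l : seq (@protocol k X)).

Lemma run_pm1 p : pm1 (run p).
Proof.
elim: p => [[]|i f p0 IH0 p1 IH1] x /=; [by left|by right|].
by case: (f _).
Qed.

Lemma cylinder_intersectionT : @cylinder_intersection k X (fun=> true).
Proof. by exists (fun _ _ => true) => x; apply/esym/forallP. Qed.

Lemma cylinder_intersectionI (chi psi : input X -> bool) :
  cylinder_intersection chi -> cylinder_intersection psi ->
  cylinder_intersection (fun x => chi x && psi x).
Proof.
move=> [a ha] [b hb]; exists (fun i v => a i v && b i v) => x.
rewrite ha hb; apply/andP/forallP => [[/forallP h1 /forallP h2] i|h].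
  by rewrite h1 h2.
by split; apply/forallP => i; case/andP: (h i).
Qed.

Lemma cylinder_intersection_see i (f : view i -> bool) :
  cylinder_intersection (fun x : input X => f (see x i)).
Proof.
(* Quantifying over all inputs with the given view avoids transporting [f]
   along an equality of player indices. *)
exists (fun j v =>
  `[< forall y : input X, see y j = v -> j = i -> f (see y i) >]) => x.
apply/idP/forallP => [fx j|/(_ i)/asboolP]; last exact.
by apply/asboolP => y + ji; rewrite ji => ->.
Qed.

Fixpoint pbind p (q : bool -> @protocol k X) : protocol :=
  match p with
  | Output b => q b
  | Write i f p0 p1 => Write f (pbind p0 q) (pbind p1 q)
  end.

Lemma run_pbind p q x : run (pbind p q) x = run (q (run p x == -1)) x.
Proof. by elim: p => [[]|i f p0 IH0 p1 IH1] //=; case: (f _). Qed.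

Lemma cost_pbind p q c : (forall b, cost (q b) <= c)%N ->
  (cost (pbind p q) <= cost p + c)%N.
Proof.
move=> hq; elim: p => [b|i f p0 IH0 p1 IH1] //=.
by rewrite addSn ltnS addn_maxl; lia.
Qed.

(** The accumulator [a] counts the accepting runs so far. The blackboard determines it, so counting
    costs no communication. *)
Fixpoint vote t l (a : nat) : @protocol k X :=
  match l with
  | [::] => Output (t < a)%N
  | p :: l' => pbind p (fun b => vote t l' (a + b))
  end.

Lemma run_vote t l a x :
  run (vote t l a) x = (-1) ^+ (t < a + count (fun p => run p x == -1%R) l)%N.
Proof.
elim: l a => [|p l IH] a /=; first by rewrite addn0.
by rewrite run_pbind IH addnA.
Qed.

Lemma cost_vote t l a c : (forall p, List.In p l -> cost p <= c)%N ->
  (cost (vote t l a) <= size l * c)%N.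
Proof.
elim: l a => [|p l IH] a //= hl.
have hp := hl p (or_introl erefl).
have hvote b : (cost (vote t l (a + b)) <= size l * c)%N.
  by apply: IH => q hq; apply: hl; right.
apply: leq_trans (cost_pbind p hvote) _.
by rewrite mulSn leq_add2r.
Qed.

End Protocols.

(** * Discrepancy against deterministic protocols *)

Section Discrepancy.
Context {R : realType} {k : nat} {X : 'I_k -> finType}.
Variables (P : input X -> R) (H : input X -> int).

Lemma disc_ge0 : 0 <= disc P H.
Proof. exact: bigmax_ge_id. Qed.

Lemma disc_cylinder (chi : input X -> bool) : cylinder_intersection chi ->
  `|\sum_x P x * (H x)%:~R * (chi x)%:R| <= disc P H.
Proof.
move=> hchi.
have -> : \sum_x P x * (H x)%:~R * (chi x)%:R =
    \sum_x P x * (H x)%:~R * (([ffun y => chi y] : {ffun input X -> bool}) x)%:R.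
  by apply: eq_bigr => x _; rewrite ffunE.
apply: (@le_bigmax_cond _ _ _ _ _ _
  (fun c : {ffun input X -> bool} => `|\sum_x P x * (H x)%:~R * (c x)%:R|)).
apply/asboolP; congr cylinder_intersection: hchi.
by apply/funext => x; rewrite ffunE.
Qed.

(* The inputs accepted by a protocol of cost c form a disjoint union of at most
   2^c cylinder intersections, one for each accepting leaf. *)
Lemma disc_protocol (p : @protocol k X) (chi : input X -> bool) :
  cylinder_intersection chi ->
  `|\sum_x P x * (H x)%:~R * (chi x && (run p x == -1))%:R| <=
    2 ^+ cost p * disc P H.
Proof.
elim: p chi => [b|i f p0 IH0 p1 IH1] chi hchi /=.
  case: b; rewrite ?expr0 ?expr1 mul1r.
    under eq_bigr do rewrite eqxx andbT.
    exact: disc_cylinder.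
  rewrite big1 ?normr0 ?disc_ge0 // => x _.
  by rewrite andbF mulr0.
have h1 := IH1 _ (cylinder_intersectionI hchi (cylinder_intersection_see f)).
have h0 := IH0 _ (cylinder_intersectionI hchi
  (cylinder_intersection_see (fun v => ~~ f v))).
have -> : \sum_x P x * (H x)%:~R *
    (chi x && ((if f (see x i) then run p1 x else run p0 x) == -1))%:R =
  \sum_x P x * (H x)%:~R * ((chi x && f (see x i)) && (run p1 x == -1))%:R +
  \sum_x P x * (H x)%:~R * ((chi x && ~~ f (see x i)) && (run p0 x == -1))%:R.
  rewrite -big_split; apply: eq_bigr => x _ /=.
  by case: (f _); rewrite ?andbT ?andbF /= ?mulr0 ?addr0 ?add0r.
apply: le_trans (ler_normD _ _) _.
have le_max n : (n <= maxn (cost p0) (cost p1))%N ->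
    2 ^+ n * disc P H <= 2 ^+ maxn (cost p0) (cost p1) * disc P H.
  by move=> hn; rewrite ler_wpM2r ?disc_ge0 // ler_eXn2l ?ltr1n.
rewrite exprS -mulrA mulr_natl mulr2n.
apply: lerD; [apply: le_trans h1 _|apply: le_trans h0 _]; apply: le_max.
  exact: leq_maxr.
exact: leq_maxl.
Qed.

(** Take [chi] identically true in [disc_protocol] and split the signed sum by the value of [H]. *)
Lemma accept_disc (p : @protocol k X) c : pm1 H -> (cost p <= c)%N ->
  \sum_(x | H x == -1) P x * (run p x == -1)%:R <=
  \sum_(x | H x == 1) P x * (run p x == -1)%:R + 2 ^+ c * disc P H.
Proof.
move=> hH hc.
have := disc_protocol p cylinder_intersectionT.
rewrite (bigID (fun x => H x == 1)) /= => hd.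
have {}hd := le_trans hd (ler_wpM2r disc_ge0
   (_ : 2 ^+ cost p <= 2 ^+ c :> R)).
move: hd; rewrite ler_eXn2l ?ltr1n // => /(_ hc).
rewrite ler_norml => /andP[+ _].
have -> : \sum_(x | H x == 1) P x * (H x)%:~R * (run p x == -1)%:R =
          \sum_(x | H x == 1) P x * (run p x == -1)%:R.
  by apply: eq_bigr => x /eqP ->; rewrite mulr1.
have -> : \sum_(x | H x != 1) P x * (H x)%:~R * (run p x == -1)%:R =
          - \sum_(x | H x == -1) P x * (run p x == -1)%:R.
  rewrite -sumrN; apply: eq_big => x; first by case: (hH x) => ->.
  by case: (hH x) => -> // _; rewrite mulrN1 mulNr.
lra.
Qed.

End Discrepancy.

(** * Error reduction by majority vote *)

Section Amplification.
Context {R : realType} {k : nat} {X : 'I_k -> finType}.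
Variables (F : input X -> int) (W : finType) (mu : W -> R).
Hypotheses (hF : pm1 F) (hmu : is_distr mu).

Definition iid n (g : {ffun 'I_n -> W}) : R := \prod_i mu (g i).

Lemma iid_distr n : is_distr (@iid n).
Proof.
case: hmu => mu0 mu1; split=> [g|]; first exact: prodr_ge0.
rewrite /iid -(bigA_distr_bigA (fun (_ : 'I_n) r => mu r)) /=.
by rewrite big1.
Qed.

Definition majority m (p : W -> @protocol k X) (g : {ffun 'I_m.*2 -> W}) :=
  vote m [seq p (g i) | i <- enum 'I_m.*2] 0.

Lemma cost_majority m p g c : (forall r, cost (p r) <= c)%N ->
  (cost (@majority m p g) <= m.*2 * c)%N.
Proof.
move=> hp; rewrite -[X in (_ <= X * _)%N](size_enum_ord m.*2).
rewrite -(size_map (fun i => p (g i))); apply: cost_vote => q.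
by elim: (enum _) => //= i s IH [<-|].
Qed.

(** The vote outputs -1 only on more than [m] acceptances. A wrong vote thus has more than [m]
    errors if [F x = 1], and at least [m] if [F x = -1], where a tie is wrong. *)
Lemma majority_wrong m p (g : {ffun 'I_m.*2 -> W}) x :
  run (majority p g) x != F x -> (m <= \sum_i (run (p (g i)) x != F x))%N.
Proof.
rewrite run_vote add0n count_map -sum1_count big_enum_cond /=.
rewrite -[X in _ -> (_ <= X)%N]/(\sum_(i : 'I_m.*2) _)%N.
set n := (\sum_(i | _) 1)%N => hw.
have [Fx|Fx] := hF x; rewrite Fx in hw *; last first.
  suff -> : (\sum_(i < m.*2) (run (p (g i)) x != 1%R) = n)%N.
    by case: ltnP hw => // hw _; apply: ltnW.
  rewrite /n [RHS]big_mkcond; apply: eq_bigr => i _ /=.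
  by case: (run_pm1 (p (g i)) x) => ->.
have : (\sum_(i < m.*2) (run (p (g i)) x != -1%R) + n = m.*2)%N.
  rewrite /n [X in (_ + X)%N]big_mkcond -big_split /=.
  rewrite -[RHS]card_ord -sum1_card; apply: eq_bigr => i _ /=.
  by case: (_ == _).
by case: ltnP hw => //= hw _; lia.
Qed.

(* Chernoff's argument: compare the indicator of m errors among 2m votes with
   [2 ^ errors / 2 ^ m], whose mean is at most ((4/3)^2 / 2)^m. *)
Lemma majority_error m p x : error_prob F mu p x <= 1 / 3 ->
  error_prob F (@iid m.*2) (majority p) x <= (8 / 9) ^+ m.
Proof.
case: hmu => mu0 mu1 herr.
pose e r := run (p r) x != F x.
have hmean : \sum_r mu r * 2 ^+ e r <= 4 / 3.
  have -> : \sum_r mu r * 2 ^+ e r = 1 + error_prob F mu p x.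
    rewrite -[X in _ = X + _]mu1 /error_prob [X in _ + X]big_mkcond -big_split; apply: eq_bigr => r _.
    by rewrite /= -/(e r); case: (e r); rewrite ?expr1 ?expr0 /=; lra.
  lra.
have hmean0 : 0 <= \sum_r mu r * 2 ^+ e r.
  by apply: sumr_ge0 => r _; rewrite mulr_ge0 ?exprn_ge0.
have pow0 : 0 < 2 ^+ m :> R by rewrite exprn_gt0.
rewrite -(ler_pM2l pow0) -exprMn.
apply: (@le_trans _ _ (\sum_(g : {ffun 'I_m.*2 -> W})
    \prod_i (mu (g i) * 2 ^+ e (g i)))).
  rewrite /error_prob mulr_sumr big_mkcond; apply: ler_sum => g _.
  rewrite big_split /= prodrXr mulrC.
  have iid0 : 0 <= iid g by case: (@iid_distr m.*2).
  case: ifP => [hw|_]; last by rewrite mulr_ge0 // exprn_ge0.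
  by rewrite ler_wpM2l // ler_eXn2l ?ltr1n //; apply: majority_wrong.
(* By independence of the coins the sum over [g] factors into a power of the mean. *)
rewrite -(bigA_distr_bigA (fun (_ : 'I_m.*2) r => mu r * 2 ^+ e r)) /=.
rewrite prodr_const card_ord -mul2n exprM.
apply: lerXn2r; rewrite ?nnegrE ?exprn_ge0 //.
apply: le_trans (lerXn2r _ _ _ hmean) _; rewrite ?nnegrE //.
lra.
Qed.

End Amplification.

(** * From protocols to bounds on [alpha] *)

Section MerlinArthur.
Context {R : realType} {k : nat} {X : 'I_k -> finType}.
Variables (F H : input X -> int) (P : input X -> R).
Hypotheses (hF : pm1 F) (hH : pm1 H) (hP : is_distr P).

Let alpha := \sum_(x | (F x == -1) && (H x == -1)) P x.
Let beta := \sum_(x | (F x == -1) && (H x == 1)) P x.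

Lemma accept_error (W : finType) (mu : W -> R) p x : is_distr mu ->
  \sum_r mu r * (run (p r) x == -1)%:R =
  if F x == -1 then 1 - error_prob F mu p x else error_prob F mu p x.
Proof.
case=> _ mu1.
have -> : error_prob F mu p x = \sum_r mu r * (run (p r) x != F x)%:R.
  rewrite /error_prob big_mkcond; apply: eq_bigr => r _.
  by case: (_ == _); rewrite /= ?mulr1 ?mulr0.
case: ifP => [/eqP ->|Fx].
  rewrite -[X in _ = X - _]mu1 -sumrB; apply: eq_bigr => r _.
  by case: (_ == _); rewrite /= ?mulr1 ?mulr0 ?subr0 ?subrr.
apply: eq_bigr => r _; have {Fx} -> : F x = 1 by case: (hF x) Fx => ->.
by case: (run_pm1 (p r) x) => ->.
Qed.

Lemma merlin_arthur_bound eps c1 c2 (W : finType) (mu : W -> R)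
    (p : c1.-tuple bool -> W -> @protocol k X) :
  0 <= eps -> is_distr mu -> (forall w r, cost (p w r) <= c2)%N ->
  (forall x, F x = -1 -> exists w, error_prob F mu (p w) x <= eps) ->
  (forall x, F x = 1 -> forall w, error_prob F mu (p w) x <= eps) ->
  (1 - eps) * alpha <= 2 ^+ c1 * (beta + eps + 2 ^+ c2 * disc P H).
Proof.
move=> eps0 hmu hc hyes hno; have [P0 P1] := hP; have [mu0 mu1] := hmu.
pose acc w x := \sum_r mu r * (run (p w r) x == -1)%:R.
have acc0 w x : 0 <= acc w x by apply: sumr_ge0 => r _; rewrite mulr_ge0.
have acc1 w x : acc w x <= 1.
  rewrite -mu1; apply: ler_sum => r _; rewrite ler_piMr //.
  by case: (_ == _).
have hw w : \sum_(x | H x == -1) P x * acc w x <=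
    beta + eps + 2 ^+ c2 * disc P H.
  have swap a : \sum_(x | H x == a) P x * acc w x =
      \sum_r mu r * \sum_(x | H x == a) P x * (run (p w r) x == -1)%:R.
    rewrite /acc; under eq_bigr do rewrite mulr_sumr.
    rewrite exchange_big; apply: eq_bigr => r _ /=.
    by rewrite mulr_sumr; apply: eq_bigr => x _; rewrite mulrCA.
  apply: (@le_trans _ _ (\sum_(x | H x == 1) P x * acc w x +
      2 ^+ c2 * disc P H)).
    rewrite !swap -[X in _ + X]mul1r -[X in _ + X * _]mu1 mulr_suml -big_split /=.
    apply: ler_sum => r _; rewrite -mulrDr ler_wpM2l //.
    exact: accept_disc.
  (* Where [F] is -1, acceptance is at most 1, which gives [beta]; elsewhere accepting is an error,
     which gives [eps]. *)
  rewrite lerD2r (bigID (fun x => F x == -1)) /=; apply: lerD.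
    under eq_bigl do rewrite andbC.
    by apply: ler_sum => x _; rewrite ler_piMr.
  apply: (@le_trans _ _ (\sum_x P x * eps)); last by rewrite -mulr_suml P1 mul1r.
  rewrite big_mkcond; apply: ler_sum => x _ /=; case: ifP => [|_].
    case/andP=> _ Fx; rewrite ler_wpM2l // /acc accept_error // (negPf Fx).
    by apply: hno; case: (hF x) Fx => ->.
  by rewrite mulr_ge0.
have -> : 2 ^+ c1 * (beta + eps + 2 ^+ c2 * disc P H) =
    \sum_(w : c1.-tuple bool) (beta + eps + 2 ^+ c2 * disc P H).
  by rewrite sumr_const card_tuple card_bool -[RHS]mulr_natl natrX.
apply: le_trans (ler_sum _ (fun w _ => hw w)).
rewrite exchange_big /alpha mulr_sumr big_mkcondl /=.
apply: ler_sum => x _.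
have tot0 : 0 <= \sum_w P x * acc w x.
  by apply: sumr_ge0 => w _; rewrite mulr_ge0.
case: ifP => // Fx.
have [w hwx] := hyes x (eqP Fx).
(* Keep only the good choice [w]; the other terms are nonnegative. *)
rewrite (bigD1 w) //= mulrC -[X in X <= _]addr0; apply: lerD.
  by rewrite ler_wpM2l // /acc accept_error // Fx lerD2l lerN2.
by apply: sumr_ge0 => v _; rewrite mulr_ge0.
Qed.

Lemma alpha_ge0 : 0 <= alpha.
Proof. by case: hP => P0 _; apply: sumr_ge0. Qed.

Lemma alpha_le1 : alpha <= 1.
Proof.
case: hP => P0 <-; rewrite /alpha big_mkcond; apply: ler_sum => x _.
by case: ifP.
Qed.

Lemma beta_ge0 : 0 <= beta.
Proof. by case: hP => P0 _; apply: sumr_ge0. Qed.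

Lemma beta_disc_ge0 : 0 <= beta + disc P H.
Proof. by rewrite addr_ge0 ?beta_ge0 ?disc_ge0. Qed.

Lemma beta_discX c :
  beta + 2 ^+ c * disc P H <= 2 ^+ c * (beta + disc P H).
Proof.
by rewrite mulrDr lerD2r ler_peMl ?beta_ge0 // exprn_ege1 ?ler1n.
Qed.

(** A nondeterministic protocol is a Merlin-Arthur protocol with a single coin outcome and error
    0. *)
Lemma nondet_bound c1 c2 (p : c1.-tuple bool -> @protocol k X) :
  nondet_protocol F c2 p -> alpha <= 2 ^+ (c1 + c2) * (beta + disc P H).
Proof.
case=> hc hyes hno.
have hmu : is_distr (fun _ : unit => 1 : R) by split=> //; rewrite sumr_const card_unit.
have err w x : run (p w) x = F x ->
    error_prob F (fun _ : unit => 1 : R) (fun=> p w) x <= 0.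
  by move=> e; rewrite /error_prob e eqxx /= big_pred0_eq.
have := merlin_arthur_bound (p := fun w _ => p w) (lexx 0) hmu (fun w _ => hc w).
rewrite subr0 mul1r addr0 exprD -mulrA => /(_ _ _)/le_trans; apply.
- by move=> x /hyes[w hw]; exists w; apply: err.
- by move=> x Fx w; apply: err; apply: hno.
- by rewrite ler_wpM2l ?exprn_ge0 // beta_discX.
Qed.

(* The factor 6 comes from (8 / 9)^6 <= 1 / 2. *)
Lemma ma_bound n c1 c2 (W : finType) (mu : W -> R)
    (p : c1.-tuple bool -> W -> @protocol k X) :
  MA_protocol F c2 mu p -> 1 <= 2 ^+ n * alpha ->
  alpha <= 2 ^+ (c1 + (6 * (c1 + 2 + n)).*2 * c2).+1 * (beta + disc P H).
Proof.
case=> hmu hc hyes hno hn; set m := (6 * _)%N.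
have a0 := alpha_ge0; have a1 := alpha_le1.
have hb : (1 - (8 / 9) ^+ m) * alpha <=
    2 ^+ c1 * (beta + (8 / 9) ^+ m + 2 ^+ (m.*2 * c2) * disc P H).
  apply: (merlin_arthur_bound (p := fun w => majority (m := m) (p w)))
    (iid_distr hmu _) _ _ _ => [|w g|x /hyes[w hw]|x Fx w].
  - by rewrite exprn_ge0.
  - exact: cost_majority.
  - by exists w; apply: majority_error.
  - by apply: majority_error => //; apply: hno.
set eps := (8 / 9) ^+ m in hb.
have eps0 : 0 <= eps by rewrite exprn_ge0.
have heps : 2 ^+ (c1 + 2 + n) * eps <= 1.
  rewrite /eps /m exprM -exprMn exprn_ile1 //; lra.
have c10 : 1 <= 2 ^+ c1 :> R by rewrite exprn_ege1 ?ler1n.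
(* The summand 2 in the exponent supplies the factor 4, and [hn] trades [2 ^+ n] for [alpha]. *)
have h4 : 2 ^+ c1 * eps * 4 <= alpha.
  apply: (@le_trans _ _ (2 ^+ (c1 + 2 + n) * eps * alpha)); last first.
    by rewrite ler_piMl.
  rewrite (_ : _ * alpha = (2 ^+ c1 * eps * 4) * (2 ^+ n * alpha)); last first.
    by rewrite !exprD; ring.
  by rewrite ler_peMr // !mulr_ge0 ?exprn_ge0.
have heps4 : eps <= 1 / 4.
  have : 1 * eps <= 2 ^+ c1 * eps by rewrite ler_wpM2r.
  lra.
have hbd := ler_wpM2l (ltW (lt_le_trans ltr01 c10)) (beta_discX (m.*2 * c2)).
have : eps * alpha <= 1 / 4 * alpha by rewrite ler_wpM2r.
(* Both error terms are at most [alpha / 4], so [alpha / 2] remains; this is the [.+1] in the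
   exponent. *)
rewrite exprS exprD -!mulrA; move: hb hbd h4; rewrite !mulrDr mulrBl.
lra.
Qed.

(** Without communication the acceptance probability is the same on all inputs. It cannot be both at
    least 2/3 and at most 1/3, so [F] is constant: either [alpha = 0], or a constant protocol is
    correct and [nondet_bound] applies. *)
Lemma ma_cost0_bound (W : finType) (mu : W -> R)
    (p : 0.-tuple bool -> W -> @protocol k X) :
  MA_protocol F 0 mu p -> alpha <= beta + disc P H.
Proof.
case=> hmu hc hyes hno.
have [[x0 Fx0]|hpos] := pselect (exists x, F x = -1); last first.
  rewrite /alpha big_pred0 ?beta_disc_ge0 // => x.
  by apply/negP => /andP[/eqP Fx _]; apply: hpos; exists x.
have acc_const x y w : \sum_r mu r * (run (p w r) x == -1)%:R =
    \sum_r mu r * (run (p w r) y == -1)%:R.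
  by apply: eq_bigr => r _; have := hc w r; case: (p w r).
have hneg x : F x = -1.
  have [//|Fx] := hF x; have [w hw] := hyes _ Fx0.
  have := acc_const x x0 w; rewrite !accept_error // Fx Fx0 /= => e_eq.
  have e1 := hno _ Fx w; have : 1 <= 2 / 3 :> R by lra.
  by rewrite ler_pdivlMr // mul1r ler_nat.
have := @nondet_bound 0 0 (fun=> Output true); rewrite mul1r; apply.
by split=> // x; rewrite hneg // => _; exists [tuple].
Qed.

End MerlinArthur.

(** * Logarithms and the final arithmetic *)

Section Logarithm.
Context {R : realType}.
Implicit Types a b : R.

Lemma ln2_gt0 : 0 < ln 2 :> R.
Proof. by rewrite ln_gt0 // ltr1n. Qed.

Lemma log2_div_le a b n : 0 <= a -> 0 <= b -> a <= 2 ^+ n * b ->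
  log2 (a / b) <= n%:R.
Proof.
move=> a0 b0 hab; rewrite /log2 ler_pdivrMr ?ln2_gt0 //.
have n0 : 0 <= n%:R * ln 2 :> R by rewrite mulr_ge0 ?(ltW ln2_gt0).
(* This covers [b = 0], where [a / b = 0] and its [ln] is 0 by convention. *)
have [/ln0 -> //|q0] := leP (a / b) 0.
have bp : 0 < b.
  by rewrite lt_neqAle b0 andbT; apply: contraTneq q0 => <-; rewrite invr0 mulr0 ltxx.
have -> : n%:R * ln 2 = ln (2 ^+ n) :> R by rewrite lnXn // mulr_natl.
by rewrite ler_ln ?posrE ?exprn_gt0 // ler_pdivrMr.
Qed.

(** Let [n] be the integer part of [log2 (2 / a)]; the 2 in the numerator absorbs the rounding. *)
Lemma log2_inv_bound a : 0 < a -> a <= 1 ->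
  exists n : nat, 1 <= 2 ^+ n * a /\ n%:R <= log2 (2 / a).
Proof.
move=> a0 a1; have ia0 : 0 < 2 / a by rewrite divr_gt0.
have L0 : 0 <= log2 (2 / a).
  rewrite divr_ge0 ?(ltW ln2_gt0) // ln_ge0 // ler_pdivlMr //; lra.
move: (Num.truncn _) (truncn_itv L0) => n /andP[le_n lt_n].
exists n; split=> //; move: lt_n; rewrite /log2 ltr_pdivrMr ?ln2_gt0 //.
rewrite [ltRHS]mulr_natl -lnXn // ltr_ln ?posrE ?exprn_gt0 //.
by rewrite ltr_pdivrMr // exprS -mulrA ltr_pMr // => /ltW.
Qed.

Lemma log2_ge1 a : 0 < a -> a <= 1 -> 1 <= log2 (2 / a).
Proof.
move=> a0 a1; rewrite /log2 ler_pdivlMr ?ln2_gt0 // mul1r.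
by rewrite ler_ln ?posrE ?divr_gt0 // ler_pdivlMr // ler_piMr.
Qed.

(** Every term of the bound on [Q] is dominated by [c * c] if [L <= c], and by [L * c] if [c <= L].
    The coefficients add up to 1 + 12 + 24 + 12 + 1 = 50. *)
Lemma min_quadratic_bound (Q L c : R) : 1 <= c -> 1 <= L ->
  Q <= c + 12 * (c + 2 + L) * c + 1 ->
  Num.min (50^-1 * Num.sqrt Q) (50^-1 * (Q / L)) <= c.
Proof.
move=> c1 L1 hQ; rewrite ge_min.
have L0 : 0 < L by apply: lt_le_trans L1.
have hcL : c <= L * c by rewrite ler_peMl //; lra.
have [leLc|/ltW lecL] := leP L c; apply/orP; [left|right].
  have hLc : L * c <= c * c by rewrite ler_wpM2r //; lra.
  have -> : c = 50^-1 * (50 * c) by rewrite mulrA mulVf ?mul1r.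
  rewrite ler_wpM2l // -(ger0_norm (_ : 0 <= 50 * c)); last by lra.
  rewrite -sqrtr_sqr ler_wsqrtr // expr2; nra.
have hcc : c * c <= L * c by rewrite ler_wpM2r //; lra.
rewrite mulrA ler_pdivrMr //; nra.
Qed.

End Logarithm.

(** * Both lower bounds, with explicit constants *)

Theorem theorem4p1 (R : realType) :
  exists c1 c2 : R, 0 < c1 /\ 0 < c2 /\
  forall (k : nat) (X : 'I_k -> finType) (F H : input X -> int)
         (P : input X -> R),
    pm1 F -> pm1 H -> is_distr P ->
    let alpha := \sum_(x | (F x == -1) && (H x == -1)) P x in
    let beta := \sum_(x | (F x == -1) && (H x == 1)) P x in
    let Q := log2 (alpha / (beta + disc P H)) in
    (Q%:E <= N_nof R F)%E /\
    ((Num.min (c1 * Num.sqrt Q) (c2 * (Q / log2 (2 / alpha))))%:E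
       <= MA_nof R F)%E.
Proof.
exists 50^-1, 50^-1; do 2![split; first by []].
move=> k X F H P hF hH hP alpha beta Q.
have a0 : 0 <= alpha := alpha_ge0 F H hP.
have a1 : alpha <= 1 := alpha_le1 F H hP.
have b0 : 0 <= beta + disc P H := beta_disc_ge0 F H hP.
split.
  apply: le_ereal_inf_tmp => _ [_ [c1 [c2 [p [hp ->]]]] <-]; rewrite lee_fin.
  by apply: log2_div_le => //; apply: nondet_bound hp.
apply: le_ereal_inf_tmp => _ [_ [c1 [c2 [W [mu [p [hp ->]]]]]] <-]; rewrite lee_fin.
(* For [Q <= 0] the square root is 0, so the minimum is at most 0. *)
have [Q0|Q0] := leP Q 0.
  by rewrite ge_min ler0_sqrtr // mulr0 ler0n.
have ap : 0 < alpha.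
  rewrite lt_neqAle a0 andbT; apply: contraTneq Q0 => a_eq0.
  by rewrite /Q -a_eq0 mul0r /log2 ln0 // mul0r ltxx.
case: (posnP (c1 + c2)) => [/eqP|c_gt0].
  rewrite addn_eq0 => /andP[/eqP c10 /eqP c20]; subst c1 c2.
  have hb := ma_cost0_bound hF hH hP hp.
  suff : Q <= 0%:R by rewrite leNgt Q0.
  by apply: log2_div_le; rewrite // mul1r.
have [n [hn nL]] := log2_inv_bound ap a1.
have hQ := log2_div_le a0 b0 (ma_bound hF hH hP hp hn).
apply: min_quadratic_bound; rewrite ?ler1n ?log2_ge1 //.
apply: le_trans hQ _.
set L := log2 _ in nL *.
(* It remains to replace [n] by [L], and [c1] and [c2] by their sum; the products below are the
   monomials this needs. *)
have c10 : 0 <= c1%:R :> R by []; have c20 : 0 <= c2%:R :> R by [].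
have n0 : 0 <= n%:R :> R by [].
have := ler_wpM2r c20 nL; have := mulr_ge0 c10 c10.
have := mulr_ge0 c10 c20; have := mulr_ge0 c10 (le_trans n0 nL).
rewrite -addn1 -mul2n !natrD !natrM !natrD; nra.
Qed.
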